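(* For every oriented virtual knot diagram $K$, the writhe polynomial $W_K(t)$, the affine index polynomial $P_K(t)$ and the integer $Q_K=\sum_{\mathrm{Ind}(c)\neq0}w(c)$ satisfy $$W_K(t)=\bigl(P_K(t)+Q_K\bigr)\,t .$$
   Context: Virtual knot diagrams are oriented and have classical (real) and virtual crossings. The writhe (sign) of a classical crossing $c$ is $w(c)\in\{+1,-1\}$. Gauss diagram: the oriented circle parametrizing the diagram, with one signed arrow for each classical crossing $c$, directed from the preimage of the overcrossing (tail of $c$) to the preimage of the undercrossing (head of $c$), with sign $w(c)$. Index: the endpoints of an arrow $c$ cut the circle into the arc $A$ running, along the orientation, from the tail of $c$ to the head of $c$, and the complementary arc $B$. Two arrows cross if their endpoints interlace. Let $r_{\pm}$ be the number of arrows of sign $\pm1$ that cross $c$ with tail in $A$ and head in $B$, and $l_{\pm}$ the number of arrows of sign $\pm1$ that cross $c$ with tail in $B$ and head in $A$. Then $\mathrm{Ind}(c)=r_+-r_--l_++l_-$. Assigned integer $N(c)$: the endpoints of all arrows divide the circle into arcs. Assign to each such arc the integer obtained as follows: start at a point of the arc, travel once around the circle along the orientation, and take the sum of the signs of all arrows whose head is met before their tail. If $w(c)=+1$, $N(c)$ is the integer just before the head of $c$ minus the integer just before the tail of $c$. If $w(c)=-1$, $N(c)$ is the integer just after the head of $c$ minus the integer just after the tail of $c$. Writhe polynomial: $f_k(t)=\sum_{c\in Odd_k(K)}w(c)t^{N(c)}$, where $Odd_k(K)$ is the set of classical crossings with $\mathrm{Ind}(c)\equiv2^k\pmod{2^{k+1}}$,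 and $W_K(t)=\sum_{k=0}^\infty f_k(t)$ (a finite sum). Affine index polynomial: an arc of the diagram is an edge from one classical crossing to the next along the orientation (virtual crossings are ignored). Label the arcs by integers so that, when passing a classical crossing of sign $\varepsilon$ along the overstrand, the label changes by $-\varepsilon$, and along the understrand it changes by $+\varepsilon$. Such a labeling exists for every virtual knot diagram and is unique up to adding a constant. At a crossing, let $a$ be the label of the incoming arc whose label decreases to $a-1$ and $b$ the label of the incoming arc whose label increases to $b+1$ (for a positive crossing, $a$ is on the overstrand; for a negative crossing, $a$ is on the understrand). The weight is $W(c)=a-b-1$ if $w(c)=+1$ and $W(c)=b+1-a$ if $w(c)=-1$. Then $P_K(t)=\sum_{c}w(c)\,(t^{W(c)}-1)$, summed over all classical crossings. In $Q_K$ the sum is over all classical crossings $c$ of $K$ with $\mathrm{Ind}(c)\ne0$. *)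

(* Defs.v *)
From HB Require Import structures.
From mathcomp Require Import all_boot all_order all_algebra.
From mathcomp Require Import classical_sets cardinality fsbigop.
Set Implicit Arguments.
Unset Strict Implicit.
Unset Printing Implicit Defensive.
Import Order.TTheory GRing.Theory Num.Theory.
Local Open Scope ring_scope.

(** * Oriented virtual knot diagrams *)

(* A diagram is an oriented closed curve in the plane with finitely many
   transverse double points.  [vcode] is the cyclic word of the passages
   through double points, read along the orientation from some base point.
   A passage is a pair (x, b): for a classical crossing, b = true on the
   overstrand and b = false on the understrand; for a virtual crossing, b names
   the two strands so that the one named true crosses the one named false from
   left to right, as the overstrand does at a positive crossing. *)

Section RotationSystem.
Variables (X : finType) (o : X -> bool) (code : seq (X * bool)).

(* The dart (x, b, d) is the end at x of the outgoing (d = true) or incoming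
   (d = false) edge of strand b of x. *)
Definition dart : Type := (X * bool * bool)%type.

(* Next dart at the same vertex, counterclockwise.  With i := o x, the order is
   out(i), out(~~ i), in(i), in(~~ i); at a classical crossing, with o x
   telling whether x is positive, this is the usual sign convention. *)
Definition dart_ccw (u : dart) : dart :=
  let: (x, b, d) := u in (x, ~~ b, if b == o x then d else ~~ d).

Definition dart_opp (u : dart) : dart :=
  let: (p, d) := u in (if d then next code p else prev code p, ~~ d).

Definition dart_face (u : dart) : dart := dart_ccw (dart_opp u).

(* Euler's formula V - E + F = 2 for the 4-valent graph traced by the curve,
   which is connected and has E = 2 V; the circle with no double point has no
   dart and is set apart. *)
Definition planar_code : bool :=
  (#|X| == 0)%N || (fcard dart_face predT == #|X| + 2)%N.

End RotationSystem.

Record virtual_knot_diagram := VirtualKnotDiagram {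
  classical_crossing : finType;
  virtual_crossing : finType;
  vpositive : classical_crossing -> bool;
  vcode : seq ((classical_crossing + virtual_crossing) * bool);
  vcode_uniq : uniq vcode;
  vcode_full : forall p, p \in vcode;
  vcode_planar :
    planar_code (fun x => if x is inl c then vpositive c else true) vcode
}.

(** * Gauss diagrams *)

(* [gcode] is the cyclic word of arrow endpoints read along the circle;
   (c, true) is the tail of c and (c, false) its head. *)
Record gauss_diagram := GaussDiagram {
  arrow : finType;
  positive : arrow -> bool;
  gcode : seq (arrow * bool);
  gcode_uniq : uniq gcode;
  gcode_full : forall p, p \in gcode
}.

Definition classical_passage (C V : finType) (p : (C + V) * bool) :
    option (C * bool) :=
  if p.1 is inl c then Some (c, p.2) else None.

Definition as_passage (C V : finType) (q : C * bool) : (C + V) * bool :=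
  (inl q.1, q.2).

Lemma classical_passageK (C V : finType) :
  ocancel (@classical_passage C V) (@as_passage C V).
Proof. by case=> [[c|v] b]. Qed.

Lemma as_passageK (C V : finType) :
  pcancel (@as_passage C V) (@classical_passage C V).
Proof. by case. Qed.

Section GaussOf.
Variable K : virtual_knot_diagram.

Let gauss_code := pmap (@classical_passage _ _) (vcode K).

Lemma gauss_code_uniq : uniq gauss_code.
Proof. exact: pmap_uniq (@classical_passageK _ _) _ (vcode_uniq K). Qed.

Lemma gauss_code_full p : p \in gauss_code.
Proof.
by rewrite (can2_mem_pmap (@classical_passageK _ _) (@as_passageK _ _)) vcode_full.
Qed.

Definition gauss : gauss_diagram :=
  @GaussDiagram _ (@vpositive K) gauss_code gauss_code_uniq gauss_code_full.

End GaussOf.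

(* Z[t, t^-1] is regarded as a subring of the field of fractions of Z[t]. *)
Definition laurent : fieldType := {fraction {poly int}}.
Definition t : laurent := FracField.tofrac ('X : {poly int}).

(** * Invariants *)

Section Invariants.
Variable G : gauss_diagram.

Definition endpoint : Type := (arrow G * bool)%type.
Definition tail (c : arrow G) : endpoint := (c, true).
Definition head (c : arrow G) : endpoint := (c, false).

Definition writhe (c : arrow G) : int := if positive c then 1 else -1.

(* [arc s x y] contains x but not y; [behead] makes the arcs open. *)
Definition arcA (c : arrow G) : seq endpoint :=
  behead (arc (gcode G) (tail c) (head c)).
Definition arcB (c : arrow G) : seq endpoint :=
  behead (arc (gcode G) (head c) (tail c)).

(* The number of arrows of sign s crossing c from A to B, resp. from B to A. *)
Definition crossAB (s : bool) (c : arrow G) : nat :=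
  #|[set d | [&& positive d == s, tail d \in arcA c & head d \in arcB c]]|.
Definition crossBA (s : bool) (c : arrow G) : nat :=
  #|[set d | [&& positive d == s, tail d \in arcB c & head d \in arcA c]]|.

Definition Ind (c : arrow G) : int :=
  (crossAB true c)%:Z - (crossAB false c)%:Z
  - (crossBA true c)%:Z + (crossBA false c)%:Z.

(* w lists the endpoints in the order they are met. *)
Definition trip_sum (w : seq endpoint) : int :=
  \sum_(d : arrow G | (index (head d) w < index (tail d) w)%N) writhe d.

(* The integers of the arcs just before and just after the endpoint p. *)
Definition int_before (p : endpoint) : int :=
  trip_sum (rot (index p (gcode G)) (gcode G)).
Definition int_after (p : endpoint) : int :=
  trip_sum (rot (index p (gcode G)).+1 (gcode G)).

Definition N (c : arrow G) : int :=
  if positive c then int_before (head c) - int_before (tail c)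
  else int_after (head c) - int_after (tail c).

Definition Odd (k : nat) : {set arrow G} :=
  [set c | (Ind c == 2%:Z ^+ k %[mod 2%:Z ^+ k.+1])%Z].

Definition f (k : nat) : laurent :=
  \sum_(c in Odd k) (writhe c)%:~R * t ^ N c.

Lemma finite_support_f : finite_set [set k | f k != 0]%classic.
Proof.
pose M := (\max_(c : arrow G) `|Ind c|)%N.
apply: (@sub_finite_set _ _ `I_M); last exact: finite_II.
move=> k /= fk; have [c cO] : exists c, c \in Odd k.
  apply/existsP; apply: contraNT fk => /existsPn nO.
  by rewrite /f big_pred0 // => c; apply/negbTE/nO.
suff : (k < `|Ind c|)%N by move/leq_trans; apply; apply: leq_bigmax.
move: cO; rewrite inE eqz_mod_dvd => /dvdzP [q Eq].
have EI : Ind c = (q * 2 + 1) * 2%:Z ^+ k.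
  by rewrite mulrDl mul1r -mulrA -exprS -Eq subrK.
have q0 : (0 < `|(q * 2 + 1)%R|)%N.
  rewrite absz_gt0; apply/eqP => /eqP; rewrite addr_eq0 => /eqP Eq1.
  by have /(congr1 odd) := congr1 absz Eq1; rewrite abszM oddM andbF.
rewrite EI abszM abszX /=; apply: leq_trans (ltn_expl k (isT : 1 < 2)%N) _.
exact: leq_pmull.
Qed.

(* This operator sums families of finite support and is 0 on the others;
   [finite_support_f] rules the latter out. *)
Definition writhe_polynomial : laurent :=
  (\sum_(k \in [set: nat]%classic) f k)%R.

(* [affine_labeling_exists] shows that this is always satisfiable.
   The arc of the diagram ending at the passage p carries the label [L p]; the
   arc leaving p is the one ending at the next passage.  Tails are passages
   along overstrands. *)
Definition is_affine_labeling (L : endpoint -> int) : Prop :=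
  forall c : arrow G,
    L (next (gcode G) (tail c)) = L (tail c) - writhe c /\
    L (next (gcode G) (head c)) = L (head c) + writhe c.

Lemma affine_labeling_exists : exists L, is_affine_labeling L.
Proof.
pose delta (p : endpoint) : int := if p.2 then - writhe p.1 else writhe p.1.
pose S (s : seq endpoint) : int := \sum_(q <- s) delta q.
have S0 : S (gcode G) = 0.
  rewrite /S (perm_big (index_enum _)) /=.
    rewrite -(pair_bigA _ (fun c b => delta (c, b))) /= big1 // => c _.
    by rewrite big_bool /delta /= addNr.
  apply: uniq_perm => [||p]; [exact: gcode_uniq|exact: index_enum_uniq|].
  by rewrite gcode_full mem_index_enum.
exists (fun p => S (take (index p (gcode G)) (gcode G))) => c.
suff H p : S (take (index (next (gcode G) p) (gcode G)) (gcode G))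
         = S (take (index p (gcode G)) (gcode G)) + delta p.
  by rewrite !H.
have := gcode_full p; have := gcode_uniq G; move: S0.
move: (gcode G) => s S0 us ps.
have ip : (index p s < size s)%N by rewrite index_mem.
have Stake : S (take (index p s) s) + delta p = S (take (index p s).+1 s).
  by rewrite (take_nth p) // /S -cats1 big_cat /= big_seq1 nth_index.
rewrite Stake next_nth ps; case: s => // y s in S0 us ps ip Stake *.
have [lt|ge] := ltnP (index p (y :: s)) (size s).
  by rewrite -[nth y s _]/(nth y (y :: s) (index p (y :: s)).+1) index_uniq.
rewrite nth_default // index_head take0 [in RHS]take_oversize //.
by rewrite S0 /S big_nil.
Qed.

Section AffineIndex.
Variable L : endpoint -> int.

Definition decreasing_label (c : arrow G) : int :=
  if positive c then L (tail c) else L (head c).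
Definition increasing_label (c : arrow G) : int :=
  if positive c then L (head c) else L (tail c).

Definition weight (c : arrow G) : int :=
  let a := decreasing_label c in let b := increasing_label c in
  if positive c then a - b - 1 else b + 1 - a.

Definition affine_index_polynomial : laurent :=
  \sum_(c : arrow G) (writhe c)%:~R * (t ^ weight c - 1).

End AffineIndex.

Definition Q : int := \sum_(c : arrow G | Ind c != 0) writhe c.

End Invariants.

(* Main.v *)
Require Import Defs.
From mathcomp Require Import all_boot all_order all_algebra.
From mathcomp Require Import zify ring.
From mathcomp Require Import classical_sets fsbigop.
Import GRing.Theory Defs.
Local Open Scope ring_scope.

(* The integers of the arcs of the circle form, up to sign, an affine labeling.
   For an arbitrary affine labeling, summing the increments of the labels along
   the arc from the tail of c to its head leaves only the arrows that cross c,
   so both N c - 1 and the weight of c are equal to Ind c.  Every nonzero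
   integer n is congruent to 2^k modulo 2^(k+1) for exactly one k, so W_K is the
   sum of w(c) t^(Ind c + 1) over the c with Ind c <> 0; the crossings of index
   0 contribute nothing to P_K. *)

(** The sum starts from [g x], not [x], to fit the open arc between a tail and a head. *)
Lemma fpath_telescope {T : eqType} (g : T -> T) (L : T -> int) x p y :
  fpath g x (rcons p y) -> L y - L (g x) = \sum_(q <- p) (L (g q) - L q).
Proof.
elim: p x => [|z p IHp] x /=.
  by rewrite andbT big_nil => /eqP ->; rewrite subrr.
by case/andP=> /eqP -> /IHp; rewrite big_cons => <-; ring.
Qed.

Lemma rot_index_next {T : eqType} (s : seq T) x : uniq s -> x \in s ->
  rot (index (next s x) s) s = rot (index x s).+1 s.
Proof.
move=> us xs; have ix : (index x s < size s)%N by rewrite index_mem.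
rewrite next_nth xs; case: s => // y s in us xs ix *.
have [lt|ge] := ltnP (index x (y :: s)) (size s).
  by rewrite -[nth y s _]/(nth y (y :: s) (index x (y :: s)).+1) index_uniq.
(* Here [x] is last: [next] wraps round to the first entry, and rotating by the full length is the
   identity. *)
by rewrite nth_default // index_head rot0 rot_oversize.
Qed.

(** If [n] is [q * 2 ^ k], the congruence says that [q] is odd, so [k] is the 2-adic valuation of
    [n]. The clause [n != 0] excludes the default value [logn 2 0 = 0]. *)
Lemma eqz_mod_two_pow (n : int) k :
  (n == 2%:Z ^+ k %[mod 2%:Z ^+ k.+1])%Z = (n != 0) && (logn 2 `|n| == k).
Proof.
rewrite eqz_mod_dvd; have p0 : 2%:Z ^+ k != 0 by rewrite expf_neq0.
have [/dvdzP [q ->]|ndvd] := boolP (2%:Z ^+ k %| n)%Z.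
  rewrite -{2}[2%:Z ^+ k]mul1r -mulrBl exprS dvdz_mul2r //.
  rewrite mulf_eq0 (negbTE p0) orbF.
  have -> : (2 %| q - 1)%Z = ~~ (2 %| q)%Z by lia.
  have [->|q0] := eqVneq q 0; first by rewrite dvdz0.
  have aq : (0 < `|q|)%N by rewrite absz_gt0.
  rewrite abszM abszX lognM ?expn_gt0 // pfactorK // -{2}[k]add0n eqn_add2r.
  by rewrite -[_ == 0%N]negbK -lt0n logn_gt0 mem_primes aq dvdzE.
have [n0|n0] := eqVneq n 0; first by rewrite n0 dvdz0 in ndvd.
have /negbTE -> /= : logn 2 `|n| != k.
  by apply: contra ndvd => /eqP <-; rewrite dvdzE abszX pfactor_dvdnn.
apply/negbTE; apply: contra ndvd => dvd.
have -> : n = n - 2%:Z ^+ k + 2%:Z ^+ k by rewrite subrK.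
by rewrite rpredD ?dvdzz // (dvdz_trans _ dvd) // exprS dvdz_mull.
Qed.

Section GaussDiagram.
Variable G : gauss_diagram.
Implicit Types (c d : arrow G) (L : endpoint G -> int).

Lemma IndE c : Ind c = \sum_d writhe d *
  (((tail d \in arcA c) && (head d \in arcB c))%:R
   - ((tail d \in arcB c) && (head d \in arcA c))%:R).
Proof.
have E (P : pred (arrow G)) s :
    (#|[set d | (positive d == s) && P d]|)%:Z
    = \sum_d ((positive d == s) && P d)%:R.
  rewrite -natz -sum1_card big_mkcond natr_sum.
  by apply: eq_bigr => d _; rewrite inE; case: ifP.
rewrite /Ind /crossAB /crossBA !E -!sumrB -big_split /=; apply: eq_bigr => d _.
by rewrite /writhe; case: (positive d) => /=; case: (_ && _); case: (_ && _).
Qed.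

Lemma sum_endpoint (F : endpoint G -> int) :
  \sum_q F q = \sum_d (F (tail d) + F (head d)).
Proof.
rewrite (eq_bigr (fun q => F (q.1, q.2))) => [|[] //].
rewrite -(pair_bigA _ (fun d b => F (d, b))) /=.
by apply: eq_bigr => d _; rewrite big_bool.
Qed.

Lemma affine_labeling_Ind L c : is_affine_labeling L ->
  L (tail c) - L (head c) - writhe c = Ind c.
Proof.
move=> HL; have := gcode_uniq G.
have tc := gcode_full (tail c); have hc := gcode_full (head c).
have nth : tail c != head c by apply/eqP=> -[].
(* Read from the tail of [c], the code is tail, [p1], head, [p2], where [p1] and [p2] are the open
   arcs A and B. *)
move=> uG; have [i p1 p2 eA eB eR] := rot_to_arc uG tc hc nth.
have uR : uniq (tail c :: p1 ++ head c :: p2) by rewrite -eR rot_uniq.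
have : fcycle (next (gcode G)) (tail c :: p1 ++ head c :: p2).
  by rewrite -eR rot_cycle cycle_next.
rewrite /= -cat_rcons rcons_cat cat_path => /andP[/(fpath_telescope _ L) tel _].
move: tel; rewrite (HL c).1 => tel.
have -> : L (tail c) - L (head c) - writhe c
    = - \sum_(q <- p1) (L (next (gcode G) q) - L q).
  by rewrite -tel; ring.
have := uR; rewrite cons_uniq cat_uniq /= mem_cat inE !negb_or.
case/andP=> /and3P[t1 _ t2] /and4P[up1 /andP[h1 dis] h2 _].
rewrite big_uniq //= big_mkcond /= sum_endpoint IndE /arcA /arcB -eA -eB /=.
rewrite -sumrN; apply: eq_bigr => d _; rewrite (HL d).1 (HL d).2.
have [->|dc] := eqVneq d c.
  by rewrite (negbTE t1) (negbTE h1) !andbF !subrr mulr0.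
have p2E b : ((d, b) \in p2) = ((d, b) \notin p1).
  have : (d, b) \in tail c :: p1 ++ head c :: p2.
    by rewrite -eR mem_rot gcode_full.
  rewrite inE mem_cat inE !xpair_eqE (negbTE dc) /=.
  have [in1 _|//] := boolP (_ \in p1); apply/negbTE; apply: contra dis => in2.
  by apply/hasP; exists (d, b).
(* The two increments of [d] cancel if both its ends lie in [p1]; one end alone in [p1] gives the
   signed contribution of [d] to [Ind c]. *)
by rewrite !p2E; case: (_ \in p1); case: (_ \in p1) => /=; ring.
Qed.

(** Moving [p] from first to last changes the order of endpoints only for its own arrow, which
    becomes counted if [p] is its tail and stops being counted if [p] is its head. *)
Lemma trip_sum_rot1 (p : endpoint G) w :
  uniq (p :: w) -> (forall q, q \in p :: w) ->
  trip_sum (rcons w p)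
  = trip_sum (p :: w) + (if p.2 then writhe p.1 else - writhe p.1).
Proof.
case/andP=> pw _ fw; have in_w q : q != p -> q \in w.
  by move=> /negbTE ne; have := fw q; rewrite inE ne.
have ix q : q != p -> index q (rcons w p) = index q w.
  by move=> /in_w qw; rewrite -cats1 index_cat qw.
have ixp : index p (rcons w p) = size w.
  by rewrite -cats1 index_cat (negbTE pw) index_head addn0.
have iy q : q != p -> index q (p :: w) = (index q w).+1.
  by move=> /negbTE ne; rewrite /= eq_sym ne.
have iyp : index p (p :: w) = 0%N by rewrite /= eqxx.
have size_w q : q != p -> (index q w < size w)%N.
  by move=> /in_w; rewrite index_mem.
rewrite /trip_sum big_mkcond [in RHS]big_mkcond.
rewrite (bigD1 p.1) // [in RHS](bigD1 p.1) // addrAC; congr (_ + _).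
  move: ix ixp iy iyp size_w; rewrite {fw pw in_w}.
  case: p => c [] ix ixp iy iyp size_w.
    have ne : head c != (c, true) by apply/eqP=> -[].
    rewrite [index (tail c) _]ixp [index (tail c) _]iyp ix // iy //.
    by rewrite size_w // add0r.
  have ne : tail c != (c, false) by apply/eqP=> -[].
  rewrite [index (head c) _]ixp [index (head c) _]iyp ix // iy //.
  by rewrite ltnNge ltnW ?size_w // subrr.
apply: eq_bigr => d dp.
have ne b : (d, b) != p by apply: contra dp => /eqP <-.
by rewrite !ix ?iy //; exact: ne.
Qed.

Lemma int_after_before (p : endpoint G) :
  int_after p = int_before p + (if p.2 then writhe p.1 else - writhe p.1).
Proof.
have ps := gcode_full p; rewrite /int_after /int_before rotS ?index_mem //.
have := rot_index ps; set w := _ ++ _ => E.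
rewrite E rot1_cons trip_sum_rot1 // -E; first by rewrite rot_uniq gcode_uniq.
by move=> q; rewrite mem_rot gcode_full.
Qed.

Lemma int_before_next (p : endpoint G) :
  int_before (next (gcode G) p) = int_after p.
Proof. by rewrite /int_before rot_index_next ?gcode_uniq ?gcode_full. Qed.

(** The sign is reversed because the integers rise by the writhe at a tail, where labels fall by
    it. *)
Lemma affine_labeling_int_before :
  is_affine_labeling (fun p : endpoint G => - int_before p).
Proof.
by move=> c; rewrite !int_before_next !int_after_before /=; split; ring.
Qed.

Lemma N_Ind c : N c = Ind c + 1.
Proof.
rewrite -(affine_labeling_Ind _ c affine_labeling_int_before).
rewrite /N !int_after_before /=.
(* For a negative [c], using the integers after the endpoints subtracts [2 * writhe c], so both
   signs give [Ind c + 1]. *)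
by rewrite /writhe; case: (positive c); ring.
Qed.

Lemma weight_Ind L c : is_affine_labeling L -> weight L c = Ind c.
Proof.
move/affine_labeling_Ind => <-.
rewrite /weight /decreasing_label /increasing_label /writhe.
by case: (positive c); ring.
Qed.

Lemma writhe_polynomialE :
  writhe_polynomial G
  = \sum_(c : arrow G | Ind c != 0) (writhe c)%:~R * t ^ N c.
Proof.
(* Beyond the largest valuation [M] every [f G k] vanishes, which makes the sum over all [k]
   finite. *)
pose lg c := logn 2 `|Ind c|; pose M := (\max_c lg c)%N.
have lgM c : (lg c < M.+1)%N by rewrite ltnS leq_bigmax.
have OddE c k : (c \in Odd G k) = (Ind c != 0) && (lg c == k).
  by rewrite inE eqz_mod_two_pow.
rewrite (partition_big (fun c => Ordinal (lgM c)) xpredT) //=.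
transitivity (\sum_(k < M.+1) f G k); last first.
  by apply: eq_bigr => k _; apply: eq_bigl => c; rewrite OddE -val_eqE.
rewrite fsbig_ord; apply/esym/fsbig_widen => // k [_ /= kM].
rewrite /f big_pred0 // => c; rewrite OddE; apply/negbTE/nandP; right.
by apply: contra_notN kM => /eqP <-.
Qed.

Lemma writhe_affine_index L : is_affine_labeling L ->
  writhe_polynomial G = (affine_index_polynomial L + (Q G)%:~R) * t.
Proof.
move=> HL; have t0 : t != 0 by rewrite tofrac_eq0 polyX_eq0.
rewrite writhe_polynomialE /affine_index_polynomial /Q rmorph_sum /=.
rewrite big_mkcond [X in _ + X]big_mkcond -big_split mulr_suml /=.
apply: eq_bigr => c _; rewrite N_Ind weight_Ind //.
have [->|_] := eqVneq (Ind c) 0.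
  by rewrite expr0z subrr mulr0 addr0 mul0r.
(* The term of [c] in [Q G] cancels the [- 1] of its term in the affine index polynomial. *)
by rewrite expfzDr // expr1z; ring.
Qed.

End GaussDiagram.

Theorem theorem3p6 (K : virtual_knot_diagram)
    (L : endpoint (gauss K) -> int) (HL : is_affine_labeling L) :
  writhe_polynomial (gauss K)
  = (affine_index_polynomial L + (Q (gauss K))%:~R) * t.
Proof. exact: writhe_affine_index. Qed.
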